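(* Let $\Delta=\{\pm\frac12(\tau_2-\tau_3),\pm\frac12(\tau_3-\tau_1),\pm\frac12(\tau_1-\tau_2)\}$ be the root system of $(\mathfrak{e}_{6,\mathbb{R}})^{\mathbb{C}}$ relative to $\mathfrak{h}_6$. Then $\Pi=\{\alpha_1,\alpha_2\}$ with $\alpha_1=\frac12(\tau_2-\tau_3)$, $\alpha_2=\frac12(\tau_3-\tau_1)$ is a fundamental root system (system of simple roots) of $(\mathfrak{e}_{6,\mathbb{R}})^{\mathbb{C}}$. The Dynkin diagram of $(\mathfrak{e}_{6,\mathbb{R}})^{\mathbb{C}}$ consists of the two vertices $\alpha_1,\alpha_2$ joined by a single edge.
   Context: Let $(\mathfrak{J}_{\mathbb{R}})^{\mathbb{C}}$ be the space of symmetric $3\times3$ complex matrices with $X\circ Y=\frac12(XY+YX)$, $(X,Y)=\mathrm{tr}(X\circ Y)$, $X\times Y=\frac12\bigl(2X\circ Y-\mathrm{tr}(X)Y-\mathrm{tr}(Y)X+(\mathrm{tr}(X)\mathrm{tr}(Y)-(X,Y))E\bigr)$. Let $(\mathfrak{e}_{6,\mathbb{R}})^{\mathbb{C}}=\{\phi\in\mathrm{Hom}_{\mathbb{C}}((\mathfrak{J}_{\mathbb{R}})^{\mathbb{C}})\mid(\phi X,X\times X)=0\ \forall X\}$ with commutator bracket ($\mathrm{Hom}_{\mathbb{C}}(V)$ denotes $\mathbb{C}$-linear endomorphisms of $V$). For $T\in(\mathfrak{J}_{\mathbb{R}})^{\mathbb{C}}$ let $\tilde TX=T\circ X$. Let $E_i$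 be the diagonal matrix with $1$ in position $(i,i)$ and $0$ elsewhere. The Cartan subalgebra $\mathfrak{h}_6$ consists of the elements $\tilde T_0$ with $T_0=\tau_1E_1+\tau_2E_2+\tau_3E_3$, $\tau_i\in\mathbb{C}$, $\tau_1+\tau_2+\tau_3=0$; the $\tau_i$ are regarded as linear functionals on $\mathfrak{h}_6$. Lengths and angles of roots are with respect to the form induced by the Killing form. *)

(* Defs.v *)
From HB Require Import structures.
From mathcomp Require Import all_boot all_order all_algebra.
From mathcomp Require Import all_classical reals.
From mathcomp Require Import complex.
Set Implicit Arguments.
Unset Strict Implicit.
Unset Printing Implicit Defensive.

Import Order.TTheory GRing.Theory Num.Theory.
Local Open Scope ring_scope.

(* A linearly closed predicate on a finite-dimensional space, as a {vspace _}. *)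
Lemma vspace_of_ex (K : fieldType) (V : vectType K) (P : V -> Prop) :
  P 0 -> (forall a u v, P u -> P v -> P (a *: u + v)) ->
  exists U : {vspace V}, forall v, v \in U <-> P v.
Proof.
move=> P0 PL.
have [n] : exists n, (\dim {:V} - n <= 0)%N by exists (\dim {:V}); rewrite subnn.
have : (0 <= \dim (0%VS : {vspace V}))%N by [].
have : forall v, v \in (0%VS : {vspace V}) -> P v.
  by move=> v; rewrite memv0 => /eqP ->.
suff H k : forall U : {vspace V}, (forall v, v \in U -> P v) ->
    (\dim {:V} - \dim U <= k)%N ->
    exists U : {vspace V}, forall v, v \in U <-> P v.
  by move=> Q0 _ _; apply: (H (\dim {:V}) _ Q0); rewrite leq_subr.
elim: k => [|k IH] U UP dU.
  exists U => v; split; first exact: UP.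
  move=> _; move: dU; rewrite leqn0 subn_eq0 => dU.
  have /eqP -> : U == fullv by rewrite eqEdim subvf dU.
  exact: memvf.
have [Uall|] := pselect (forall v, P v -> v \in U).
  by exists U => v; split; [exact: UP | exact: Uall].
move=> /existsNP[v /not_implyP[Pv /negP vU]].
apply: (IH (<[v]> + U)%VS).
  move=> w /memv_addP[x /vlineP[a ->] [y yU ->]].
  by apply: PL => //; exact: UP.
have lt : (\dim U < \dim (<[v]> + U))%N.
  rewrite ltn_neqAle dimvS ?addvSr // andbT; apply: contra vU => /eqP dE.
  have /eqP -> : U == (<[v]> + U)%VS by rewrite eqEdim addvSr dE /=.
  by apply: (subvP (addvSl _ _)); exact: memv_line.
have := leq_sub2l (\dim {:V}) lt.
rewrite subnS => /leq_trans; apply.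
by rewrite -ltnS; move: dU; case: (_ - _)%N.
Qed.

Definition vspace_of (K : fieldType) (V : vectType K) (P : V -> Prop)
    (P0 : P 0) (PL : forall a u v, P u -> P v -> P (a *: u + v)) : {vspace V} :=
  sval (cid (vspace_of_ex P0 PL)).

Lemma mem_vspace_of (K : fieldType) (V : vectType K) (P : V -> Prop) P0 PL v :
  v \in vspace_of (P := P) P0 PL <-> P v.
Proof. exact: (svalP (cid (vspace_of_ex P0 PL))). Qed.

Section LinearLieAlgebra.
Variables (K : numClosedFieldType) (U : vectType K).

Definition lie (f g : 'End(U)) : 'End(U) := (f \o g)%VF - (g \o f)%VF.

(* tr (ad x \o ad y), the trace being taken on the Lie algebra g. *)
Definition killing (g : {vspace 'End(U)}) (x y : 'End(U)) : K :=
  \sum_(i < \dim g) coord (vbasis g) i (lie x (lie y (vbasis g)`_i)).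

Section Roots.
Variables (g h : {vspace 'End(U)}).

Definition dual := 'Hom(subvs_of h, K^o).

Definition is_root (a : dual) : Prop :=
  a != 0 /\
  exists x, [/\ x \in g, x != 0 &
                forall H : subvs_of h, lie (vsval H) x = (a H : K) *: x].

(* The map t |-> killing g t - from h to its dual. *)
Definition killing_flat : 'Hom(subvs_of h, dual) :=
  linfun (fun t : subvs_of h =>
    linfun (fun s : subvs_of h => killing g (vsval t) (vsval s) : K^o) : dual).

(* The form induced on the dual of h by the Killing form: (a, b) is
   killing g t_a t_b, where t_a is the element of h with killing g t_a - = a.
   The linear-map inverse below is the genuine inverse as soon as the
   restriction of the Killing form to h is nondegenerate. *)
Definition dual_form (a b : dual) : K :=
  killing g (vsval ((killing_flat^-1)%VF a)) (vsval ((killing_flat^-1)%VF b)).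

Definition rlength (a : dual) : K := sqrtC (dual_form a a).

Definition cos_angle (a b : dual) : K :=
  dual_form a b / (rlength a * rlength b).

Definition simple_system n (Pi : n.-tuple dual) : Prop :=
  [/\ basis_of fullv Pi,
      forall i, is_root (tnth Pi i) &
      forall b, is_root b ->
        exists m : 'I_n -> nat,
          b = \sum_(i < n) tnth Pi i *+ m i \/
          b = - (\sum_(i < n) tnth Pi i *+ m i)].

Record diagram n := Diagram {
  edges : 'I_n -> 'I_n -> nat;
  arrow : rel 'I_n
}.

(* Distinct simple roots at angle t are joined by 4 cos^2 t edges, with an
   arrow towards the shorter one when they are joined and differ in length. *)
Definition is_dynkin_diagram n (Pi : n.-tuple dual) (D : diagram n) : Prop :=
  (forall i, edges D i i = 0%N /\ arrow D i i = false) /\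
  (forall i j, i != j ->
     (edges D i j)%:R = 4 * cos_angle (tnth Pi i) (tnth Pi j) ^+ 2 /\
     arrow D i j =
       (0 < edges D i j)%N && (rlength (tnth Pi j) < rlength (tnth Pi i))).

Lemma lie_linear_r x : linear (lie x).
Proof.
move=> a u v; rewrite /lie comp_lfunDr comp_lfunDl -comp_lfunZr -comp_lfunZl.
by rewrite scalerBr opprD addrACA.
Qed.

Lemma lie_linear_l x : linear (lie^~ x).
Proof.
move=> a u v; rewrite /lie comp_lfunDr comp_lfunDl -comp_lfunZr -comp_lfunZl.
by rewrite scalerBr opprD addrACA.
Qed.

Lemma killing_linear_r x : linear (killing g x : _ -> K^o).
Proof.
move=> a u v; rewrite /killing scaler_sumr -big_split /=; apply: eq_bigr => i _.
by rewrite lie_linear_l lie_linear_r linearP.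
Qed.

Lemma killing_linear_l y : linear (killing g ^~ y : _ -> K^o).
Proof.
move=> a u v; rewrite /killing scaler_sumr -big_split /=; apply: eq_bigr => i _.
by rewrite lie_linear_l linearP.
Qed.

Lemma killing_flatE t s : (killing_flat t s : K) = killing g (vsval t) (vsval s).
Proof.
pose f1 (t : subvs_of h) (s : subvs_of h) : K^o := killing g (vsval t) (vsval s).
have l1 t' : linear (f1 t').
  by move=> a u v; rewrite /f1 linearP killing_linear_r.
pose F1 t' : {linear _ -> _} := HB.pack (f1 t')
  (GRing.isLinear.Build _ _ _ _ (f1 t') (l1 t')).
have l1E t' s' : linfun (f1 t') s' = f1 t' s' by rewrite (lfunE (F1 t')).
pose f2 (t : subvs_of h) : dual := linfun (f1 t).
have l2 : linear f2.
  move=> a u v; apply/lfunP => w; rewrite /f2 add_lfunE scale_lfunE !l1E.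
  by rewrite /f1 linearP killing_linear_l.
pose F2 : {linear _ -> _} := HB.pack f2 (GRing.isLinear.Build _ _ _ _ f2 l2).
by rewrite /killing_flat -/f2 (lfunE F2) /= /f2 l1E.
Qed.

End Roots.
End LinearLieAlgebra.

Section E6R.
Variable R : realType.
Local Notation C := R[i].

Fact sym_lin (a : C) (u v : 'M[C]_3) :
  u^T = u -> v^T = v -> (a *: u + v)^T = a *: u + v.
Proof. by move=> uT vT; rewrite linearP /= uT vT. Qed.

Definition symJ : {vspace 'M[C]_3} :=
  vspace_of (P := fun X => X^T = X) (@trmx0 C 3 3) sym_lin.

Definition J := subvs_of symJ.

Lemma mem_symJ (X : 'M[C]_3) : X \in symJ <-> X^T = X.
Proof. exact: mem_vspace_of. Qed.

Definition jprod (X Y : J) : J :=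
  vsproj symJ (2^-1 *: (vsval X *m vsval Y + vsval Y *m vsval X)).

Lemma jprodE X Y :
  vsval (jprod X Y) = 2^-1 *: (vsval X *m vsval Y + vsval Y *m vsval X).
Proof.
apply: vsprojK; apply/mem_symJ; rewrite linearZ linearD /= !trmx_mul.
have sT (Z : J) : (vsval Z)^T = vsval Z by apply/mem_symJ; exact: subvsP.
by rewrite !sT addrC.
Qed.

Lemma jprodC X Y : jprod X Y = jprod Y X.
Proof. by apply: val_inj; rewrite /= !jprodE addrC. Qed.

Lemma jprod_linear_r T : linear (jprod T).
Proof.
move=> a u v; apply: val_inj; rewrite linearP /= !jprodE.
have -> : vsval (a *: u + v) = a *: vsval u + vsval v by rewrite linearP.
rewrite mulmxDl mulmxDr -scalemxAl -scalemxAr addrACA.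
rewrite [LHS]scalerDr -(scalerDr a) !scalerA.
by congr (_ + _); congr (_ *: _); rewrite mulrC.
Qed.

Definition jtr (X : J) : C := \tr (vsval X).

Definition jinner (X Y : J) : C := jtr (jprod X Y).

Definition jE : J := vsproj symJ 1%:M.

Lemma jE_val : vsval jE = 1%:M.
Proof. by apply: vsprojK; apply/mem_symJ; rewrite trmx1. Qed.

Definition jcross (X Y : J) : J :=
  2^-1 *: (2 *: jprod X Y - jtr X *: Y - jtr Y *: X
           + (jtr X * jtr Y - jinner X Y) *: jE).

Definition e6_pred (phi : 'End(J)) : Prop :=
  forall X : J, jinner (phi X) (jcross X X) = 0.

Lemma jinner_linear_l Y : linear (jinner^~ Y : J -> C^o).
Proof.
move=> a u v; rewrite /jinner /jtr !(jprodC _ Y) jprod_linear_r.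
have -> (X Z : J) : vsval (a *: X + Z) = a *: vsval X + vsval Z.
  by rewrite linearP.
by rewrite mxtraceD mxtraceZ.
Qed.

Fact e6_pred0 : e6_pred 0.
Proof.
move=> X; rewrite zero_lfunE; have := jinner_linear_l (jcross X X) (- 1) 0 0.
by rewrite scaler0 addr0 scaleN1r addNr.
Qed.

Fact e6_pred_lin (a : C) (u v : 'End(J)) :
  e6_pred u -> e6_pred v -> e6_pred (a *: u + v).
Proof.
move=> eu ev X; rewrite add_lfunE scale_lfunE jinner_linear_l eu ev.
by rewrite scaler0 addr0.
Qed.

Definition e6 : {vspace 'End(J)} := vspace_of e6_pred0 e6_pred_lin.

Lemma mem_e6 phi : phi \in e6 <-> e6_pred phi.
Proof. exact: mem_vspace_of. Qed.

Definition jE_ (i : 'I_3) : J := vsproj symJ (delta_mx i i).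

Lemma jE__val i : vsval (jE_ i) = delta_mx i i.
Proof. by apply: vsprojK; apply/mem_symJ; rewrite trmx_delta. Qed.

Definition jdiag (t : 'I_3 -> C) : J := \sum_(i < 3) t i *: jE_ i.

Definition tilde (T : J) : 'End(J) := linfun (jprod T).

Lemma tildeE T X : tilde T X = jprod T X.
Proof.
pose F : {linear _ -> _} := HB.pack (jprod T)
  (GRing.isLinear.Build _ _ _ _ (jprod T) (jprod_linear_r T)).
exact: (lfunE F).
Qed.

Definition h6_pred (phi : 'End(J)) : Prop :=
  exists t : 'I_3 -> C, \sum_(i < 3) t i = 0 /\ phi = tilde (jdiag t).

Lemma tilde_linear : linear tilde.
Proof.
move=> a u v; apply/lfunP => X; rewrite add_lfunE scale_lfunE !tildeE.
by rewrite !(jprodC _ X) jprod_linear_r.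
Qed.

Lemma jdiag_linear (a : C) (t s : 'I_3 -> C) :
  jdiag (fun i => a * t i + s i) = a *: jdiag t + jdiag s.
Proof.
rewrite /jdiag scaler_sumr -big_split; apply: eq_bigr => i _.
by rewrite scalerDl scalerA.
Qed.

Fact h6_pred_lin (a : C) (u v : 'End(J)) :
  h6_pred u -> h6_pred v -> h6_pred (a *: u + v).
Proof.
move=> [t [t0 ->]] [s [s0 ->]]; exists (fun i => a * t i + s i); split.
  by rewrite big_split -mulr_sumr /= t0 s0 mulr0 addr0.
by rewrite jdiag_linear tilde_linear.
Qed.

Fact h6_pred0 : h6_pred 0.
Proof.
exists (fun=> 0); split; first by rewrite big1.
rewrite /jdiag big1 => [|i _]; last by rewrite scale0r.
apply/lfunP => X; rewrite tildeE zero_lfunE; apply: val_inj.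
by rewrite /= jprodE linear0 mul0mx mulmx0 addr0 scaler0.
Qed.

Definition h6 : {vspace 'End(J)} := vspace_of h6_pred0 h6_pred_lin.

Lemma mem_h6 phi : phi \in h6 <-> h6_pred phi.
Proof. exact: mem_vspace_of. Qed.

(* Since tilde T E = T, the coordinate tau_i of tilde T_0 is read off as the
   i-th diagonal entry of its value at E (see tauE). *)
Definition tau (i : 'I_3) : dual h6 :=
  linfun (fun phi : subvs_of h6 => (vsval (vsval phi jE)) i i : C^o).

Lemma tauE (i : 'I_3) (t : 'I_3 -> C) (phi : subvs_of h6) :
  vsval phi = tilde (jdiag t) -> (tau i phi : C) = t i.
Proof.
move=> phiE.
pose f (phi : subvs_of h6) : C^o := (vsval (vsval phi jE)) i i.
have fl : linear f.
  by move=> a u v; rewrite /f linearP add_lfunE scale_lfunE linearP !mxE.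
pose F : {linear _ -> _} := HB.pack f (GRing.isLinear.Build _ _ _ _ f fl).
rewrite /tau -/f (lfunE F) /= /f phiE tildeE jprodE jE_val mulmx1 mul1mx.
have -> (A : 'M[C]_3) : 2^-1 *: (A + A) = A.
  by rewrite -mulr2n -(scaler_nat 2 A) scalerA mulVf ?pnatr_eq0 // scale1r.
rewrite /jdiag.
rewrite raddf_sum summxE.
have tE j : (vsval (t j *: jE_ j)) i i = t j * (j == i)%:R.
  by rewrite linearZ /= jE__val !mxE eq_sym andbb.
rewrite (bigD1 i) //= big1 ?addr0 => [|j ji]; first by rewrite tE eqxx mulr1.
by rewrite tE (negbTE ji) mulr0.
Qed.

Definition tau1 : dual h6 := tau 0.
Definition tau2 : dual h6 := tau 1.
Definition tau3 : dual h6 := tau 2.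

Definition alpha1 : dual h6 := 2^-1 *: (tau2 - tau3).
Definition alpha2 : dual h6 := 2^-1 *: (tau3 - tau1).

Definition Delta : seq (dual h6) :=
  [:: 2^-1 *: (tau2 - tau3); - (2^-1 *: (tau2 - tau3));
      2^-1 *: (tau3 - tau1); - (2^-1 *: (tau3 - tau1));
      2^-1 *: (tau1 - tau2); - (2^-1 *: (tau1 - tau2))].

End E6R.

(* Two vertices joined by a single edge, without arrow. *)
Definition single_edge_diagram : diagram 2 :=
  @Diagram 2 (fun i j => nat_of_bool (i != j)) (fun _ _ => false).

(* Main.v *)
(* The condition (phi X, X x X) = 0 is the first-order invariance of the
   determinant, X x X being the adjugate of X.  Comparing the coefficients of
   this cubic form in X shows that the endomorphisms satisfying it are exactly
   the maps L_A : X |-> A X + X A^T with tr A = 0, so that A |-> L_A is an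
   isomorphism of sl_3 with e6.  It carries the diagonal matrix diag(tau_i / 2)
   to an element of h6, whence the matrix unit E_pq has weight
   (tau_p - tau_q) / 2.  Since ad x ad y is diagonal on these root vectors and
   kills h6 for x, y in h6, the Killing form on h6 is
   (3/2) sum_i tau_i tau_i', which gives (alpha, alpha) = 1/3 for all roots and
   (alpha1, alpha2) = -1/6. *)
From HB Require Import structures.
Require Import Defs.
From mathcomp Require Import all_boot all_order all_algebra.
From mathcomp Require Import all_classical reals.
From mathcomp Require Import complex.
From mathcomp Require Import ring.
Set Implicit Arguments.
Unset Strict Implicit.
Unset Printing Implicit Defensive.
Import Order.TTheory GRing.Theory Num.Theory.
Local Open Scope ring_scope.

(** * Linear algebra: commutators, traces and dual bases *)

(** Makes [A |-> L_A] a morphism of Lie algebras: the mixed terms [A X B^T] and [B X A^T] cancel. *)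
Lemma congr_commutator (K : comNzRingType) n (A B X : 'M[K]_n) :
  A *m (B *m X + X *m B^T) + (B *m X + X *m B^T) *m A^T
    - (B *m (A *m X + X *m A^T) + (A *m X + X *m A^T) *m B^T)
  = (A *m B - B *m A) *m X + X *m (A *m B - B *m A)^T.
Proof.
rewrite [in RHS]linearB /= !trmx_mul !(mulmxDr, mulmxDl).
rewrite !(mulmxN, mulNmx) !mulmxA.
by apply/matrixP => i j; rewrite ![in LHS]mxE ![in RHS]mxE; ring.
Qed.

(* A trace computation that needs no basis of [g] adapted to [ad x \o ad y]. *)
Lemma killing_sum (K : numClosedFieldType) (U : vectType K)
    (g : {vspace 'End(U)}) (x y : 'End(U)) (I : finType) (D : pred I)
    (xi : I -> {linear 'End(U) -> K^o}) (w : I -> 'End(U)) :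
  (forall i, D i -> w i \in g) ->
  (forall v, v \in g -> lie x (lie y v) = \sum_(i | D i) (xi i v : K) *: w i) ->
  killing g x y = \sum_(i | D i) (xi i (w i) : K).
Proof.
move=> wg xyE; rewrite /killing.
transitivity (\sum_(k < \dim g) \sum_(i | D i)
    (xi i (vbasis g)`_k : K) * coord (vbasis g) k (w i)).
  apply: eq_bigr => k _; rewrite xyE; last first.
    by apply: vbasis_mem; rewrite mem_nth ?size_tuple.
  by rewrite linear_sum; apply: eq_bigr => i _; rewrite linearZ.
rewrite exchange_big; apply: eq_bigr => i Di /=.
(* Expanding [w i] in the basis identifies the trace of the rank-one map [v |-> xi i v *: w i] with
   [xi i (w i)]. *)
rewrite [in RHS](coord_vbasis (wg i Di)) linear_sum; apply: eq_bigr => k _.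
by rewrite linearZ /= mulrC.
Qed.

Lemma form_linear (K : fieldType) (V : vectType K) (f : 'Hom(V, K^o)) c d u v :
  f (c *: u - d *: v) = c * f u - d * f v :> K.
Proof. by rewrite linearB !linearZ. Qed.

(** The expansion of [u] gives [a = a(v) f - a(w) g] for every functional [a]; evaluation at [v]
    shows that [f] is no multiple of [g]. The minus sign suits [coweight 0], where the second simple
    root takes the value -1. *)
Lemma dual_basis2 (K : fieldType) (V : vectType K) (f g : 'Hom(V, K^o)) v w :
  f v = 1 :> K -> g v = 0 :> K -> g != 0 ->
  (forall u, u = (f u : K) *: v - (g u : K) *: w) -> basis_of fullv [:: f; g].
Proof.
move=> fv gv g0 uE; rewrite /basis_of free_cons seq1_free span_seq1.
apply/and3P; split=> //.
  rewrite eqEsubv subvf; apply/subvP => a _.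
  have -> : a = (a v : K) *: f - (a w : K) *: g.
    apply/lfunP => u; rewrite [in LHS](uE u) form_linear.
    rewrite add_lfunE opp_lfunE !scale_lfunE.
    by congr (_ - _); apply: mulrC.
  by rewrite rpredB // memvZ // memv_span // !inE eqxx ?orbT.
apply/vlineP => -[k /lfunP/(_ v)]; rewrite scale_lfunE fv gv scaler0 => /eqP.
by rewrite oner_eq0.
Qed.

(** * Symmetric matrices: entries, trace form and adjugate *)

Section E6.
Variable R : realType.
Local Notation C := R[i].
Local Notation J := (J R).

Lemma jval_sym (X : J) p q : vsval X p q = vsval X q p.
Proof. by have /mem_symJ {1}<- := subvsP X; rewrite mxE. Qed.

Lemma jvalD (X Y : J) : vsval (X + Y) = vsval X + vsval Y.
Proof. exact: linearD. Qed.

Lemma jvalZ a (X : J) : vsval (a *: X) = a *: vsval X.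
Proof. exact: linearZ. Qed.

Lemma jvalN (X : J) : vsval (- X) = - vsval X.
Proof. exact: linearN. Qed.

Lemma jval_inj (X Y : J) : vsval X = vsval Y -> X = Y.
Proof. exact: val_inj. Qed.

Lemma jval_sum (I : finType) (F : I -> J) :
  vsval (\sum_i F i) = \sum_i vsval (F i).
Proof. exact: raddf_sum. Qed.

(** Any ordering of the indices is allowed, so that later identities in [i], [j], [k] may be
    permuted. *)
Lemma sum_ord3 (i j k : 'I_3) (F : 'I_3 -> C) :
  i != j -> i != k -> j != k -> \sum_l F l = F i + F j + F k.
Proof.
move=> ij ik jk; rewrite (bigD1 i) //= (bigD1 j) 1?eq_sym //=.
rewrite (bigD1 k) /= 1?eq_sym ?ik 1?eq_sym ?jk // big1 ?addr0 ?addrA // => l.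
by case: i j k l ij ik jk =>
  [[|[|[|//]]] ?] [[|[|[|//]]] ?] [[|[|[|//]]] ?] [[|[|[|//]]] ?].
Qed.

Lemma ord3_cover (i j k l : 'I_3) :
  i != j -> i != k -> j != k -> [\/ l = i, l = j | l = k].
Proof.
case: i j k l =>
  [[|[|[|//]]] ?] [[|[|[|//]]] ?] [[|[|[|//]]] ?] [[|[|[|//]]] ?] //.
all: by move=> _ _ _; (apply: Or31 + apply: Or32 + apply: Or33); apply: val_inj.
Qed.

Lemma ord3_third (i j : 'I_3) : i != j -> exists2 k, i != k & j != k.
Proof.
by case: i j => [[|[|[|//]]] ?] [[|[|[|//]]] ?] // _;
  (exists 0 + exists 1 + exists 2).
Qed.

Lemma jinnerE (X Y : J) : jinner X Y = \sum_p \sum_q vsval X p q * vsval Y p q.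
Proof.
rewrite /jinner /jtr jprodE mxtraceZ mxtraceD (mxtrace_mulC (vsval Y)).
transitivity (\tr (vsval X *m vsval Y)); first by field.
apply: eq_bigr => p _; rewrite mxE; apply: eq_bigr => q _.
by rewrite (jval_sym Y).
Qed.

Lemma jcross_entryE (X : J) p q :
  vsval (jcross X X) p q = (\sum_r vsval X p r * vsval X r q)
    - (\sum_r vsval X r r) * vsval X p q
    + 2^-1 * ((\sum_r vsval X r r) ^+ 2
              - \sum_r \sum_s vsval X r s * vsval X r s) * (p == q)%:R.
Proof.
rewrite /jcross jvalZ !(jvalD, jvalN, jvalZ) jE_val jprodE jinnerE !mxE.
by rewrite /jtr /mxtrace; field.
Qed.

(* [jcross X X] is the adjugate of [X]. *)
Lemma jinner_jcross (i j k : 'I_3) (X Y : J) :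
  i != j -> i != k -> j != k ->
  let x := vsval X in let y := vsval Y in
  jinner Y (jcross X X) =
    y i i * (x j j * x k k - x j k ^+ 2) + y j j * (x i i * x k k - x i k ^+ 2)
    + y k k * (x i i * x j j - x i j ^+ 2)
    + 2 * (y j k * (x i j * x i k - x i i * x j k)
           + y i k * (x i j * x j k - x j j * x i k)
           + y i j * (x i k * x j k - x k k * x i j)).
Proof.
move=> ij ik jk x y; rewrite jinnerE !(sum_ord3 _ ij ik jk) !jcross_entryE.
rewrite !(sum_ord3 _ ij ik jk) !eqxx !(eq_sym k) !(eq_sym j i).
rewrite (negbTE ij) (negbTE ik) (negbTE jk) -/x -/y.
rewrite /x /y !(jval_sym _ k i) !(jval_sym _ k j) !(jval_sym _ j i) /=.
by field.
Qed.

(** * Symmetrised matrix units and the maps [L_A] *)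

Definition sE p q : J := vsproj (symJ R) (delta_mx p q + delta_mx q p).

Lemma sE_val p q : vsval (sE p q) = delta_mx p q + delta_mx q p.
Proof.
by apply: vsprojK; apply/mem_symJ; rewrite linearD /= !trmx_delta addrC.
Qed.

Lemma sEC p q : sE p q = sE q p.
Proof. by apply: jval_inj; rewrite !sE_val addrC. Qed.

(** The double sum is [X + X^T], that is, twice [X]. *)
Lemma sE_sum (X : J) : X = 2^-1 *: \sum_p \sum_q vsval X p q *: sE p q.
Proof.
apply: jval_inj; rewrite jvalZ.
have -> : vsval (\sum_p \sum_q vsval X p q *: sE p q) = vsval X + (vsval X)^T.
  rewrite jval_sum [in RHS](matrix_sum_delta (vsval X)) raddf_sum -big_split /=.
  apply: eq_bigr => p _; rewrite jval_sum raddf_sum -big_split /=.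
  apply: eq_bigr => q _.
  by rewrite sE_val scalerDr linearZ /= trmx_delta.
have /mem_symJ -> := subvsP X.
by rewrite scalerDr -scalerDl -[LHS]scale1r; congr (_ *: _); field.
Qed.

(** The derivative at the identity of the congruence action [X |-> g X g^T]. *)
Definition congr_act (A : 'M[C]_3) (X : J) : J :=
  vsproj (symJ R) (A *m vsval X + vsval X *m A^T).

Lemma congr_actE A X : vsval (congr_act A X) = A *m vsval X + vsval X *m A^T.
Proof.
apply: vsprojK; apply/mem_symJ; rewrite linearD /= !trmx_mul trmxK.
by have /mem_symJ -> := subvsP X; rewrite addrC.
Qed.

Lemma congr_act_linear A : linear (congr_act A).
Proof.
move=> a u v; apply: jval_inj; rewrite jvalD jvalZ !congr_actE jvalD jvalZ.
by rewrite mulmxDr mulmxDl -scalemxAr -scalemxAl scalerDr addrACA.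
Qed.

(* Kept opaque: unfolding [linfun] makes conversion tests very slow. *)
Fact congr_lfun_sig :
  {L : 'M[C]_3 -> 'End(J) | forall A X, L A X = congr_act A X}.
Proof.
pose F A : {linear _ -> _} := HB.pack (congr_act A)
  (GRing.isLinear.Build _ _ _ _ (congr_act A) (congr_act_linear A)).
by exists (fun A => linfun (F A)) => A X; rewrite lfunE.
Qed.

Definition congr_lfun : 'M[C]_3 -> 'End(J) := sval congr_lfun_sig.

Lemma congr_lfunE A X : vsval (congr_lfun A X) = A *m vsval X + vsval X *m A^T.
Proof. by rewrite /congr_lfun (svalP congr_lfun_sig) congr_actE. Qed.

Lemma congr_lfun_linear : linear congr_lfun.
Proof.
move=> a A B; apply/lfunP => X; apply: jval_inj.
rewrite add_lfunE scale_lfunE jvalD jvalZ !congr_lfunE linearP /=.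
by rewrite mulmxDl mulmxDr -scalemxAl -scalemxAr scalerDr addrACA.
Qed.

HB.instance Definition _ :=
  GRing.isLinear.Build _ _ _ _ congr_lfun congr_lfun_linear.

Lemma lie_congr_lfun A B :
  lie (congr_lfun A) (congr_lfun B) = congr_lfun (A *m B - B *m A).
Proof.
apply/lfunP => X; apply: jval_inj; rewrite /lie.
rewrite add_lfunE opp_lfunE !comp_lfunE jvalD jvalN !congr_lfunE.
exact: congr_commutator.
Qed.

(** As [X x X] is the adjugate of [X], the cubic form of [L_A] is [2 tr(A) det X]. *)
Lemma congr_lfun_e6 A : \tr A = 0 -> congr_lfun A \in e6 R.
Proof.
have n01 : (0 : 'I_3) != 1 by []. have n02 : (0 : 'I_3) != 2 by [].
have n12 : (1 : 'I_3) != 2 by [].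
move=> trA; apply/mem_e6 => X; rewrite (jinner_jcross _ _ n01 n02 n12) /=.
rewrite congr_lfunE !mxE !(sum_ord3 _ n01 n02 n12) !mxE.
rewrite !(jval_sym X 1 0) !(jval_sym X 2 0) !(jval_sym X 2 1).
move: trA; rewrite /mxtrace (sum_ord3 _ n01 n02 n12) => trA.
have -> : A 2 2 = - A 0 0 - A 1 1 by rewrite -[LHS]subr0 -trA; ring.
ring.
Qed.

(** Recovers [A] from [L_A]: the entry [(p, q)] of [L_A (sE q q)] is [2 A p q] off the diagonal and
    [4 A p p] on it, whence the divisor. *)
Definition congr_mx (phi : 'End(J)) : 'M[C]_3 :=
  \matrix_(p, q) (vsval (phi (sE q q)) p q / (2 * 2 ^+ (p == q))).

Lemma congr_mx_linear : linear congr_mx.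
Proof.
move=> a u v; apply/matrixP => p q.
by rewrite !mxE add_lfunE scale_lfunE jvalD jvalZ !mxE mulrDl mulrA.
Qed.

HB.instance Definition _ :=
  GRing.isLinear.Build _ _ _ _ congr_mx congr_mx_linear.

Lemma congr_lfun_sE A k l p q :
  vsval (congr_lfun A (sE k l)) p q =
    A p k * (l == q)%:R + A p l * (k == q)%:R
    + (A q l * (k == p)%:R + A q k * (l == p)%:R).
Proof.
have mul_deltaE (B : 'M[C]_3) r s i j :
    (B *m delta_mx r s) i j = B i r * (s == j)%:R.
  rewrite mxE (bigD1 r) //= big1 ?addr0 => [|t /negPf tr]; rewrite !mxE.
    by rewrite eqxx [j == s]eq_sym.
  by rewrite tr mulr0.
rewrite congr_lfunE sE_val mulmxDr mulmxDl.
have trE r s : delta_mx r s *m A^T = (A *m delta_mx s r)^T.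
  by rewrite trmx_mul trmx_delta.
by rewrite !trE [LHS]mxE ![(_ + _ : 'M_3) _ _]mxE ![_^T _ _]mxE !mul_deltaE.
Qed.

Lemma congr_lfunK : cancel congr_lfun congr_mx.
Proof.
move=> A; apply/matrixP => p q; rewrite mxE congr_lfun_sE eqxx [q == p]eq_sym.
by case: (eqVneq p q) => [->|_] /=; field.
Qed.

(** * Every element of [e6] is some [L_A] with [tr A = 0] *)

Definition sE_coef (phi : 'End(J)) k l p q : C := vsval (phi (sE k l)) p q.

(* As [sE i i] is twice [E_i], the diagonal entries of [X] are [2 a, 2 b, 2 c]. *)
Lemma e6_cubic phi (i j k : 'I_3) :
  e6_pred phi -> i != j -> i != k -> j != k -> forall a b c d e f : C,
   let P := sE_coef phi in
   let y p q := a * P i i p q + b * P j j p q + c * P k k p q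
              + d * P j k p q + e * P i k p q + f * P i j p q in
    y i i * (4 * b * c - d ^+ 2) + y j j * (4 * a * c - e ^+ 2)
    + y k k * (4 * a * b - f ^+ 2)
    + 2 * (y j k * (f * e - 2 * a * d) + y i k * (f * d - 2 * b * e)
           + y i j * (e * d - 2 * c * f)) = 0.
Proof.
move=> ePhi ij ik jk a b c d e f P y.
pose X : J := a *: sE i i + b *: sE j j + c *: sE k k
            + d *: sE j k + e *: sE i k + f *: sE i j.
have yE p q : vsval (phi X) p q = y p q.
  by rewrite /X !linearD !linearZ /= !mxE.
have xE p q : vsval X p q = a * ((p == i) && (q == i))%:R *+ 2
   + b * ((p == j) && (q == j))%:R *+ 2 + c * ((p == k) && (q == k))%:R *+ 2
   + d * (((p == j) && (q == k))%:R + ((p == k) && (q == j))%:R)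
   + e * (((p == i) && (q == k))%:R + ((p == k) && (q == i))%:R)
   + f * (((p == i) && (q == j))%:R + ((p == j) && (q == i))%:R).
  by rewrite /X !(jvalD, jvalZ) !sE_val !mxE; ring.
have := ePhi X; rewrite (jinner_jcross _ _ ij ik jk); cbv zeta.
rewrite !yE !xE !eqxx !(eq_sym k) !(eq_sym j i).
by rewrite (negbTE ij) (negbTE ik) (negbTE jk) /= => <-; ring.
Qed.

(** The hypothesis kills the coefficients [P l l p l]; the cubic at small integer points then
    isolates the remaining ones, one index pattern at a time. *)
Lemma e6_eq0 psi : e6_pred psi ->
  (forall p q, vsval (psi (sE q q)) p q = 0) -> psi = 0.
Proof.
move=> ePsi psi0.
pose P := sE_coef psi.
have PC k l p q : P k l p q = P k l q p by rewrite /P /sE_coef jval_sym.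
have PC' k l p q : P k l p q = P l k p q by rewrite /P /sE_coef sEC.
have Pll l p : P l l p l = 0 by exact: psi0.
have Pll' l p : P l l l p = 0 by rewrite PC.
have Q i j k ij ik jk := @e6_cubic psi i j k ePsi ij ik jk.
(* Characteristic zero: if a positive multiple of [x] combines two vanishing values, then
   [x = 0]. *)
have lin n (x c d e1 e2 : C) :
    e1 = 0 -> e2 = 0 -> n.+1%:R * x = c * e1 + d * e2 -> x = 0.
  move=> -> ->; rewrite !mulr0 addr0 => /eqP; rewrite mulf_eq0 pnatr_eq0 /=.
  by move/eqP.
(* At [a = 1], [c = 1] or [-1], the cubic is [4 c (P i i j j + c P k k j j)]. *)
have P1 i j k : i != j -> i != k -> j != k -> P i i j j = 0.
  move=> ij ik jk.
  have := Q _ _ _ ij ik jk 1 0 1 0 0 0; have := Q _ _ _ ij ik jk 1 0 (-1) 0 0 0.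
  rewrite /= -/P !Pll ?Pll' => H1 H2.
  by apply: (lin 7 _ (-1) 1 _ _ H1 H2); ring.
(* At [a = 1] with [d] free, the cubic is [- d^3 P j k i i - 4 d P i i j k - 4 d^2 P j k j k]; the
   values 1, 2, -1 of [d] separate the terms. *)
have P2 i j k : i != j -> i != k -> j != k ->
    [/\ P i i j k = 0, P j k i i = 0 & P j k j k = 0].
  move=> ij ik jk.
  have H1 := Q _ _ _ ij ik jk 1 0 0 1 0 0.
  have H2 := Q _ _ _ ij ik jk 1 0 0 2 0 0.
  have H3 := Q _ _ _ ij ik jk 1 0 0 (-1) 0 0.
  have P3 : P j k j k = 0.
    move: H1 H3; rewrite /= -/P !Pll ?Pll' => H1 H3.
    by apply: (lin 7 _ (-1) (-1) _ _ H1 H3); ring.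
  move: H1 H2; rewrite /= -/P !Pll ?Pll' !P3 => H1 H2; split=> //.
    by apply: (lin 23 _ (-8) 1 _ _ H1 H2); ring.
  by apply: (lin 5 _ 2 (-1) _ _ H1 H2); ring.
(* At [a = c = d = 1] only [4 P j k j j] survives. *)
have P5 i j k : i != j -> i != k -> j != k -> P j k j j = 0.
  move=> ij ik jk; have [P3 P4 P5] := P2 _ _ _ ij ik jk.
  have := Q _ _ _ ij ik jk 1 0 1 1 0 0.
  have [ji ki kj] : [/\ j != i, k != i & k != j] by rewrite !(eq_sym k) eq_sym.
  rewrite /= -/P !Pll !P3 !P4 !P5 !(P1 _ _ _ ij ik jk).
  rewrite !(P1 _ _ _ ki kj ij) !(P1 _ _ _ kj ki ji) => H.
  by apply: (lin 3 _ 1 0 _ _ H H); ring.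
(* With [d = e = 1], passing from [b = 0] to [b = 1] changes the cubic by [- 4 P j k i k], up to
   known zeros. *)
have P6 i j k : i != j -> i != k -> j != k -> P j k i k = 0.
  move=> ij ik jk; have [P3 P4 P7] := P2 _ _ _ ij ik jk.
  have [ji ki kj] : [/\ j != i, k != i & k != j] by rewrite !(eq_sym k) eq_sym.
  have [P8 P9 P10] := P2 _ _ _ ji jk ik.
  have H1 := Q _ _ _ ij ik jk 0 1 0 1 1 0.
  have H2 := Q _ _ _ ij ik jk 0 0 0 1 1 0.
  move: H1 H2; rewrite /= -/P ?Pll !P3 !P4 !P7 !P8 !P9 !P10.
  rewrite !(P1 _ _ _ ji jk ik) ?(P5 _ _ _ ij ik jk).
  rewrite ?(P5 _ _ _ ji jk ik) => H1 H2.
  by apply: (lin 3 _ (-1) 1 _ _ H1 H2); ring.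
have PE i j k : i != j -> i != k -> j != k ->
    forall r s, P i i r s = 0 /\ P i j r s = 0.
  move=> ij ik jk r s.
  have [ji ki kj] : [/\ j != i, k != i & k != j] by rewrite !(eq_sym k) eq_sym.
  have [P3 _ _] := P2 _ _ _ ij ik jk; have [_ P7 P8] := P2 _ _ _ ki kj ij.
  have P9 : P i j i i = 0 := P5 _ _ _ ki kj ij.
  have P10 : P i j j j = 0 by rewrite PC'; exact: P5 kj ki ji.
  have P11 : P i j i k = 0 by rewrite PC' PC; exact: P6 kj ki ji.
  have P12 : P i j j k = 0 by rewrite PC; exact: P6 ki kj ij.
  have P13 := P1 _ _ _ ij ik jk; have P14 := P1 _ _ _ ik ij kj.
  by case: (ord3_cover r ij ik jk) => ->; case: (ord3_cover s ij ik jk) => ->;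
    split=> //; rewrite PC.
have psiE k l : psi (sE k l) = 0.
  apply: jval_inj; apply/matrixP => r s; rewrite linear0 mxE -[LHS]/(P k l r s).
  have [->|kl] := eqVneq k l.
    have [j lj] : exists j : 'I_3, l != j.
      by case: l => [[|[|[|//]]] ?]; [exists 1 | exists 0 | exists 0].
    have [i li ji] := ord3_third lj.
    by have [] := PE _ _ _ lj li ji r s.
  have [j kj lj] := ord3_third kl.
  by have [] := PE _ _ _ kl kj lj r s.
apply/lfunP => X; rewrite zero_lfunE (sE_sum X) linearZ linear_sum /=.
rewrite big1 ?scaler0 // => p _.
by rewrite linear_sum big1 // => q _; rewrite linearZ /= psiE scaler0.
Qed.

(** At diagonal arguments the coefficient of [a b c] in the cubic is 16 times this trace; the signed
    sum of four values extracts it four times, whence 64. *)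
Lemma e6_tr0 (phi : 'End(J)) : e6_pred phi -> \tr (congr_mx phi) = 0.
Proof.
have n01 : (0 : 'I_3) != 1 by []. have n02 : (0 : 'I_3) != 2 by [].
have n12 : (1 : 'I_3) != 2 by [].
move=> /e6_cubic /(_ n01 n02 n12) Q.
have H1 := Q 1 1 1 0 0 0; have H2 := Q 1 1 (-1) 0 0 0.
have H3 := Q 1 (-1) 1 0 0 0; have H4 := Q (-1) 1 1 0 0 0.
rewrite /mxtrace (sum_ord3 _ n01 n02 n12) !mxE !eqxx expr1.
rewrite -!/(sE_coef _ _ _ _ _).
have sub0 (x y : C) : x = 0 -> y = 0 -> x - y = 0.
  by move=> -> ->; rewrite subr0.
have scale0 (x e : C) : e = 0 -> x = 64^-1 * e -> x = 0.
  by move=> ->; rewrite mulr0.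
have := sub0 _ _ (sub0 _ _ (sub0 _ _ H1 H2) H3) H4; cbv zeta => H.
by apply: (scale0 _ _ H); field.
Qed.

(** The difference of the two sides lies in [e6], by [e6_tr0] and [congr_lfun_e6], and satisfies the
    vanishing required by [e6_eq0]. *)
Lemma congr_mxK phi : phi \in e6 R -> congr_lfun (congr_mx phi) = phi.
Proof.
move=> phi_e6; apply/esym/eqP; rewrite -subr_eq0; apply/eqP/e6_eq0.
  apply/mem_e6; rewrite rpredB //; apply/congr_lfun_e6/e6_tr0.
  exact/mem_e6.
move=> p q; have /matrixP/(_ p q) := congr_lfunK (congr_mx phi).
have nz : (2 * 2 ^+ (p == q))^-1 != 0 :> C.
  by rewrite invr_eq0 mulf_neq0 ?expf_neq0 ?pnatr_eq0.
rewrite [LHS]mxE [RHS]mxE => /(mulIf nz) E.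
by rewrite add_lfunE opp_lfunE jvalD jvalN [LHS]mxE [X in _ + X]mxE E subrr.
Qed.

(** * The Cartan subalgebra and the roots *)

Local Notation h6 := (h6 R).
Local Notation e6 := (e6 R).

(** Indices start at 0: [alpha1] is [tau_root 1 2], [alpha2] is [tau_root 2 0], and [Delta] lists
    the six cases [p != q]. *)
Definition tau_root (p q : 'I_3) : dual h6 := 2^-1 *: (tau R p - tau R q).

Lemma tau_rootE p q H : tau_root p q H = (tau R p H - tau R q H) / 2 :> C.
Proof. by rewrite /tau_root scale_lfunE add_lfunE opp_lfunE mulrC. Qed.

Lemma jdiag_val (t : 'I_3 -> C) : vsval (jdiag t) = diag_mx (\row_i t i).
Proof.
rewrite /jdiag jval_sum diag_mx_sum_delta; apply: eq_bigr => i _.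
by rewrite jvalZ jE__val mxE.
Qed.

Lemma tilde_jdiag (t : 'I_3 -> C) :
  tilde (jdiag t) = congr_lfun (diag_mx (\row_i (t i / 2))).
Proof.
have -> : diag_mx (\row_i (t i / 2)) = 2^-1 *: diag_mx (\row_i t i).
  by apply/matrixP => p q; rewrite !mxE mulrnAr mulrC.
apply/lfunP => X; apply: jval_inj; rewrite tildeE jprodE congr_lfunE jdiag_val.
by rewrite linearZ /= tr_diag_mx -scalemxAl -scalemxAr scalerDr.
Qed.

Lemma h6_val (H : subvs_of h6) :
  vsval H = congr_lfun (diag_mx (\row_i (tau R i H / 2))).
Proof.
have /mem_h6[t [_ Ht]] := subvsP H; rewrite {1}Ht tilde_jdiag.
congr (congr_lfun (diag_mx _)); apply/rowP => i.
by rewrite !mxE (tauE i Ht).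
Qed.

Lemma sum_tau (H : subvs_of h6) : \sum_i (tau R i H : C) = 0.
Proof.
have /mem_h6[t [t0 Ht]] := subvsP H; rewrite -[RHS]t0.
by apply: eq_bigr => i _; rewrite (tauE i Ht).
Qed.

Definition h6_diag (t : 'I_3 -> C) : subvs_of h6 := vsproj h6 (tilde (jdiag t)).

Lemma tau_h6_diag t i : \sum_i t i = 0 -> tau R i (h6_diag t) = t i :> C.
Proof.
by move=> t0; apply: tauE; rewrite vsprojK //; apply/mem_h6; exists t.
Qed.

Lemma congr_lfun0 : congr_lfun 0 = 0 :> 'End(J).
Proof. exact: linear0. Qed.

Lemma congr_lfunZ a A : congr_lfun (a *: A) = a *: congr_lfun A :> 'End(J).
Proof. exact: linearZ. Qed.

(** The commutator with [diag(d)] multiplies the entry [(p, q)] by [d_p - d_q]; here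
    [d_i = tau_i / 2]. *)
Lemma lie_h6 (H : subvs_of h6) A : lie (vsval H) (congr_lfun A) =
  congr_lfun (\matrix_(p, q) ((tau_root p q H : C) * A p q)).
Proof.
rewrite h6_val lie_congr_lfun; congr congr_lfun; apply/matrixP => p q.
by rewrite mul_diag_mx mul_mx_diag !mxE tau_rootE; field.
Qed.

Lemma lie_h6_delta (H : subvs_of h6) p q :
  lie (vsval H) (congr_lfun (delta_mx p q)) =
  (tau_root p q H : C) *: congr_lfun (delta_mx p q).
Proof.
rewrite lie_h6 -congr_lfunZ; congr congr_lfun; apply/matrixP => r s.
rewrite !mxE.
by case: (eqVneq r p) => [->|_]; case: (eqVneq s q) => [->|_]; rewrite ?mulr0.
Qed.

Lemma congr_delta_e6 p q : p != q -> congr_lfun (delta_mx p q) \in e6.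
Proof.
move=> pq; apply: congr_lfun_e6; rewrite /mxtrace big1 // => i _; rewrite mxE.
by case: (eqVneq i p) => [->|//]; rewrite (negPf pq).
Qed.

Lemma tau_root_neq0 p q : p != q -> tau_root p q != 0.
Proof.
move=> pq; have [k pk qk] := ord3_third pq.
(* At [E_p - E_q] the functional takes the value 1. *)
pose t l : C := (l == p)%:R - (l == q)%:R.
have t0 : \sum_l t l = 0.
  rewrite (sum_ord3 _ pq pk qk) /t !eqxx (negPf pq) (eq_sym q) (negPf pq).
  by rewrite !(eq_sym k) (negPf pk) (negPf qk) /=; ring.
apply/eqP => /lfunP/(_ (h6_diag t)).
rewrite tau_rootE !tau_h6_diag // zero_lfunE.
rewrite /t !eqxx (negPf pq) (eq_sym q) (negPf pq) subr0 sub0r opprK -mulr2n.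
by rewrite divff ?pnatr_eq0 //; apply/eqP; rewrite oner_eq0.
Qed.

(** An eigenvector is some [L_A]; comparing one nonzero entry [(p, q)] of [A] determines the weight,
    and [p != q] because a root is nonzero. *)
Lemma is_rootP a : is_root e6 a <-> exists p q, p != q /\ a = tau_root p q.
Proof.
split=> [[a0 [x [xg x0 xa]]]|[p [q [pq ->]]]]; last first.
  split; first exact: tau_root_neq0.
  exists (congr_lfun (delta_mx p q)); split; first exact: congr_delta_e6.
    apply/eqP => /(congr1 congr_mx); rewrite congr_lfunK linear0.
    by move/matrixP/(_ p q)/eqP; rewrite !mxE !eqxx oner_eq0.
  by move=> H; exact: lie_h6_delta.
have [A xE] : exists A, x = congr_lfun A.
  by exists (congr_mx x); rewrite congr_mxK.
have [p [q Apq]] : exists p q, A p q != 0.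
  apply: contra_notP (negP x0) => /forallNP A0.
  rewrite xE -congr_lfun0; apply/eqP; congr congr_lfun.
  apply/matrixP => p q; rewrite mxE.
  have /forallNP/(_ q)/negP := A0 p.
  by rewrite negbK => /eqP.
have aE : a = tau_root p q.
  apply/lfunP => H; have := xa H; rewrite xE lie_h6 -congr_lfunZ.
  move/(can_inj congr_lfunK)/matrixP/(_ p q); rewrite !mxE.
  by move/(mulIf Apq).
exists p, q; split=> //; apply: contra_neq a0 => pq.
by apply/lfunP => H; rewrite aE pq tau_rootE subrr mul0r zero_lfunE.
Qed.

Lemma tau_rootN p q : - tau_root p q = tau_root q p.
Proof. by rewrite /tau_root -scalerN opprB. Qed.

Lemma mem_Delta a : is_root e6 a <-> a \in Delta R.
Proof.
have -> : Delta R =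
    [:: tau_root 1 2; tau_root 2 1; tau_root 2 0;
        tau_root 0 2; tau_root 0 1; tau_root 1 0].
  by rewrite -(tau_rootN 1 2) -(tau_rootN 2 0) -(tau_rootN 0 1).
rewrite !in_cons in_nil orbF; split.
  case/is_rootP => p [q []].
  by case: (@ord3_cover 0 1 2 p isT isT isT) => ->;
    case: (@ord3_cover 0 1 2 q isT isT isT) => -> // _ ->; rewrite eqxx ?orbT.
move=> aD; apply/is_rootP; case/or4P: aD => [| | |/or3P[]] /eqP ->;
  [by exists 1, 2 | by exists 2, 1 | by exists 2, 0
  | by exists 0, 2 | by exists 0, 1 | by exists 1, 0].
Qed.

(** * The Killing form on [h6] and the induced form on roots *)

Lemma congr_lfun_sum (I : finType) (F : I -> 'M[C]_3) :
  congr_lfun (\sum_i F i) = \sum_i congr_lfun (F i).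
Proof. exact: linear_sum. Qed.

(** Without the denominators the double sum is [6 sum a_i b_i - 2 (sum a_i) (sum b_i)]. *)
Lemma sum_diff_prod (a b : 'I_3 -> C) : \sum_i a i = 0 -> \sum_i b i = 0 ->
  \sum_p \sum_q (a p - a q) / 2 * ((b p - b q) / 2) =
  3 / 2 * \sum_i a i * b i.
Proof.
have n01 : (0 : 'I_3) != 1 by []. have n02 : (0 : 'I_3) != 2 by [].
have n12 : (1 : 'I_3) != 2 by [].
rewrite !(sum_ord3 _ n01 n02 n12) => sa sb.
have -> : a 2 = - a 0 - a 1 by rewrite -[LHS]subr0 -sa; ring.
have -> : b 2 = - b 0 - b 1 by rewrite -[LHS]subr0 -sb; ring.
by field.
Qed.

Lemma killing_h6 (H H' : subvs_of h6) : killing e6 (vsval H) (vsval H') =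
  3 / 2 * \sum_i (tau R i H : C) * (tau R i H' : C).
Proof.
pose c (u : 'I_3 * 'I_3) : C :=
  (tau_root u.1 u.2 H : C) * (tau_root u.1 u.2 H' : C).
pose f u (phi : 'End(J)) : C^o := c u * congr_mx phi u.1 u.2.
have fl u : linear (f u).
  move=> a v1 v2; rewrite /f congr_mx_linear !mxE mulrDr.
  by congr (_ + _); rewrite mulrCA.
pose xi u : {linear 'End(J) -> C^o} := HB.pack (f u)
  (GRing.isLinear.Build _ _ _ _ (f u) (fl u)).
(* Diagonal units are excluded: [L] of such a unit is not in [e6], and [c] vanishes there. *)
pose D (u : 'I_3 * 'I_3) := u.1 != u.2.
pose w (u : 'I_3 * 'I_3) : 'End(J) := congr_lfun (delta_mx u.1 u.2).
rewrite (@killing_sum _ _ _ _ _ _ D xi w); first last.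
- move=> v vg; rewrite -[in LHS](congr_mxK vg) !lie_h6.
  set M := \matrix_(p, q) _.
  have -> : M = \sum_(u : 'I_3 * 'I_3) M u.1 u.2 *: delta_mx u.1 u.2.
    by rewrite [LHS]matrix_sum_delta pair_big.
  rewrite congr_lfun_sum [RHS]big_mkcond; apply: eq_bigr => u _.
  rewrite congr_lfunZ /M mxE mxE mulrA -/(c u) /D; case: eqP => //= uE.
  by rewrite /c tau_rootE uE subrr !mul0r scale0r.
- by move=> u; exact: congr_delta_e6.
transitivity (\sum_p \sum_q c (p, q)).
  rewrite pair_big /= [LHS]big_mkcond /=.
  apply: eq_bigr => -[p q] _; rewrite /D /=.
  case: eqP => /= [->|_]; first by rewrite /c /= !tau_rootE subrr !mul0r.
  by rewrite /f /= congr_lfunK !mxE !eqxx mulr1.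
rewrite -sum_diff_prod ?sum_tau //.
by apply: eq_bigr => p _; apply: eq_bigr => q _; rewrite /c !tau_rootE.
Qed.

Lemma h6_inj (H H' : subvs_of h6) :
  (forall i, tau R i H = tau R i H') -> H = H'.
Proof.
move=> HE; apply: val_inj; rewrite -[LHS]/(vsval H) -[RHS]/(vsval H') !h6_val.
by congr (congr_lfun (diag_mx _)); apply/rowP => i; rewrite !mxE HE.
Qed.

Lemma sum_delta (p : 'I_3) (b : 'I_3 -> C) : \sum_l (l == p)%:R * b l = b p.
Proof.
rewrite (bigD1 p) //= eqxx mul1r big1 ?addr0 // => l /negPf ->.
exact: mul0r.
Qed.

(** The vector [t_a] representing [a = tau_root p q] through the Killing form. For [p != q] the
    usual coroot [2 t_a / (a, a)] is 6 times it. *)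
Definition coroot (p q : 'I_3) : subvs_of h6 :=
  h6_diag (fun l => ((l == p)%:R - (l == q)%:R) / 3).

Lemma tau_coroot p q l :
  tau R l (coroot p q) = ((l == p)%:R - (l == q)%:R) / 3 :> C.
Proof.
apply: tau_h6_diag; rewrite -mulr_suml sumrB.
have sum1 (r : 'I_3) : \sum_l (l == r)%:R = 1 :> C.
  rewrite -[RHS](sum_delta r (fun=> 1)).
  by apply: eq_bigr => i _; rewrite mulr1.
by rewrite !sum1 subrr mul0r.
Qed.

Lemma killing_coroot p q H :
  killing e6 (vsval (coroot p q)) (vsval H) = tau_root p q H.
Proof.
rewrite killing_h6 tau_rootE.
transitivity (3 / 2 * \sum_l ((l == p)%:R * (tau R l H : C)
   - (l == q)%:R * (tau R l H : C)) / 3).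
  by congr (_ * _); apply: eq_bigr => l _; rewrite tau_coroot; field.
by rewrite -mulr_suml sumrB !(sum_delta _ (fun l => (tau R l H : C))); field.
Qed.

(** Ensures that the inverse in [dual_form] is genuine. Pairing with the [coroot p q] makes all
    [tau_i] equal on the kernel, and their sum is zero. *)
Lemma killing_flat_inj : lker (killing_flat e6 h6) == 0%VS.
Proof.
rewrite -subv0; apply/subvP => H; rewrite memv_ker memv0 => /eqP H0.
have tauE p q : tau R p H = tau R q H :> C.
  have : killing e6 (vsval H) (vsval (coroot p q)) = 0.
    by rewrite -killing_flatE H0 zero_lfunE.
  (* The formula is symmetric, so the two arguments can be exchanged. *)
  rewrite killing_h6; under eq_bigr do rewrite mulrC.
  rewrite -killing_h6 killing_coroot tau_rootE => /eqP.
  by rewrite mulf_eq0 invr_eq0 pnatr_eq0 orbF subr_eq0 => /eqP.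
apply/eqP/h6_inj => i; rewrite linear0; apply/eqP.
have := sum_tau H; under eq_bigr do rewrite (tauE _ i).
by rewrite sumr_const card_ord => /eqP; rewrite mulrn_eq0.
Qed.

Lemma dual_form_root p q r s : dual_form e6 (tau_root p q) (tau_root r s) =
  ((p == r)%:R - (p == s)%:R - (q == r)%:R + (q == s)%:R) / 6.
Proof.
have flatE i j : (killing_flat e6 h6)^-1%VF (tau_root i j) = coroot i j.
  rewrite -[RHS](lker0_lfunK killing_flat_inj); congr (_ _).
  by apply/lfunP => H; rewrite killing_flatE killing_coroot.
by rewrite /dual_form !flatE killing_coroot tau_rootE !tau_coroot; field.
Qed.

(** * Simple roots and the Dynkin diagram *)

(** The trace-free part of [2 E_k]; [coweight 1] and [- coweight 0] form the basis dual to [alpha1],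
    [alpha2]. *)
Definition coweight (k : 'I_3) : subvs_of h6 :=
  h6_diag (fun l => 2 * (l == k)%:R - 2 / 3).

Lemma tau_coweight k l : tau R l (coweight k) = 2 * (l == k)%:R - 2 / 3 :> C.
Proof.
apply: tau_h6_diag; rewrite sumrB sumr_const card_ord -mulr_sumr.
have -> : \sum_l (l == k)%:R = 1 :> C.
  rewrite -[RHS](sum_delta k (fun=> 1)).
  by apply: eq_bigr => i _; rewrite mulr1.
by rewrite -mulr_natr; field.
Qed.

Lemma tau_root_coweight p q k :
  tau_root p q (coweight k) = (p == k)%:R - (q == k)%:R :> C.
Proof. by rewrite tau_rootE !tau_coweight; field. Qed.

Lemma tau_rootD p q r : tau_root p q + tau_root q r = tau_root p r.
Proof. by apply/lfunP => H; rewrite add_lfunE !tau_rootE; field. Qed.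

Lemma h6_coweight (H : subvs_of h6) :
  H = (tau_root 1 2 H : C) *: coweight 1 - (tau_root 2 0 H : C) *: coweight 0.
Proof.
move: (coweight 1) (coweight 0) (tau_coweight 1) (tau_coweight 0).
move=> W1 W0 E1 E0.
apply: h6_inj => i; rewrite form_linear E1 E0 !tau_rootE.
have := sum_tau H; rewrite (@sum_ord3 0 1 2) //.
set t := fun i => (tau R i H : C).
rewrite -![tau R _ H]/(t _) => sH.
have t2 : t 2 = - t 0 - t 1 by rewrite -[LHS]subr0 -sH; ring.
by case: (@ord3_cover 0 1 2 i isT isT isT) => -> /=; rewrite t2; field.
Qed.

Lemma alpha_basis : basis_of fullv [:: tau_root 1 2; tau_root 2 0].
Proof.
apply: (@dual_basis2 _ _ _ _ (coweight 1) (coweight 0)).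
- by rewrite tau_root_coweight subr0.
- by rewrite tau_root_coweight subr0.
- exact: tau_root_neq0.
- exact: h6_coweight.
Qed.

Lemma alpha_simple_system :
  simple_system e6 [tuple tau_root 1 2; tau_root 2 0].
Proof.
split; first exact: alpha_basis.
  by case=> [[|[|//]] ?]; apply/is_rootP; [exists 1, 2 | exists 2, 0].
move=> b /is_rootP[p [q [pq ->]]].
pose m (x y : nat) (i : 'I_2) := if i == 0 then x else y.
have mE x y :
    \sum_(i < 2) tnth [tuple tau_root 1 2; tau_root 2 0] i *+ m x y i =
    tau_root 1 2 *+ x + tau_root 2 0 *+ y.
  by rewrite big_ord_recl big_ord1.
(* The third positive root: [tau_root 1 0] is [alpha1 + alpha2]. *)
have D := tau_rootD 1 2 0.
case: (@ord3_cover 0 1 2 p isT isT isT) pq => ->;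
  case: (@ord3_cover 0 1 2 q isT isT isT) => -> // _.
- exists (m 1 1)%N; right; by rewrite mE !mulr1n D tau_rootN.
- exists (m 0 1)%N; right; by rewrite mE mulr0n mulr1n add0r tau_rootN.
- exists (m 1 1)%N; left; by rewrite mE !mulr1n D.
- exists (m 1 0)%N; left; by rewrite mE mulr0n mulr1n addr0.
- exists (m 0 1)%N; left; by rewrite mE mulr0n mulr1n add0r.
- exists (m 1 0)%N; right; by rewrite mE mulr0n mulr1n addr0 tau_rootN.
Qed.

(** The cosine is [(-1/6) / (1/3) = -1/2], so [4 cos^2 = 1]; equal lengths exclude an arrow. *)
Lemma alpha_dynkin :
  is_dynkin_diagram e6 [tuple tau_root 1 2; tau_root 2 0] single_edge_diagram.
Proof.
split=> [i | i j ij]; first by rewrite /= eqxx.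
have lengthE k : dual_form e6 (tnth [tuple tau_root 1 2; tau_root 2 0] k)
    (tnth [tuple tau_root 1 2; tau_root 2 0] k) = 1 / 3.
  by case: k => [[|[|//]] ?]; rewrite dual_form_root /=; field.
have formE : dual_form e6 (tnth [tuple tau_root 1 2; tau_root 2 0] i)
    (tnth [tuple tau_root 1 2; tau_root 2 0] j) = - 6^-1.
  by case: i j ij => [[|[|//]] ?] [[|[|//]] ?] //= _;
    rewrite dual_form_root /=; field.
rewrite /cos_angle /rlength !lengthE formE -expr2 sqrtCK ltxx /= ij; split=> //.
by rewrite [true%:R]mulr1n; field.
Qed.

End E6.

Theorem theorem4p12 (R : realType) :
  [/\ (forall a : dual (h6 R), is_root (e6 R) a <-> a \in Delta R),
      simple_system (e6 R) [tuple alpha1 R; alpha2 R] &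
      is_dynkin_diagram (e6 R) [tuple alpha1 R; alpha2 R] single_edge_diagram].
Proof.
split; [exact: mem_Delta | exact: alpha_simple_system | exact: alpha_dynkin].
Qed.
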